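(* Let $r \ge 0$, let $P_0 \in \mathcal{M}(\mathbb{R}^n)$, and assume that the set $\mathcal{X} \subseteq \mathbb{R}^n$ is nonempty and compact. If $\|\cdot\|_*$ is the $\infty$-norm on $\mathbb{R}^n$, then the problem $$\inf_{x \in \mathcal{X}} \Big\{ \mathbb{E}_{P_0}[\boldsymbol{w}^\top x] + r \sup_{v \in \mathcal{X}} \|x - v\|_* \Big\}$$ is equivalent to the following optimization problem in the variables $x$ and $\lambda$: $$\begin{aligned} &\text{minimize} && \mathbb{E}_{P_0}[\boldsymbol{w}^\top x] + r\lambda \\ &\text{subject to} && x \in \mathcal{X}, \ \lambda \in \mathbb{R}, \\ &&& \sigma_{\mathcal{X}}(e_i) - e_i^\top x \le \lambda, \quad i = 1, \dots, n, \\ &&& \sigma_{\mathcal{X}}(-e_i) + e_i^\top x \le \lambda, \quad i = 1, \dots, n. \end{aligned}$$ Equivalence means that the two problems have the same optimal value, and that a point $x \in \mathcal{X}$ is an optimal solution of the first problem if and only if there exists $\lambda \in \mathbb{R}$ such that $(x, \lambda)$ is an optimal solution of the second problem.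
   Context: $\mathcal{M}(\mathbb{R}^n)$ denotes the collection of Borel probability measures $P$ on $\mathbb{R}^n$ with $\mathbb{E}_P[\|\boldsymbol{w}\|] < \infty$, where $\boldsymbol{w}$ denotes a random vector in $\mathbb{R}^n$ with distribution $P$ under $\mathbb{E}_P$, and $\|\cdot\|$ is a norm on $\mathbb{R}^n$ whose dual norm is $\|x\|_* := \sup\{x^\top y \mid \|y\| \le 1\}$ (so $\|\cdot\|$ is the 1-norm when $\|\cdot\|_*$ is the $\infty$-norm). The support function of $\mathcal{X}$ is $\sigma_{\mathcal{X}}(y) := \sup_{x \in \mathcal{X}} x^\top y$ for $y \in \mathbb{R}^n$. The vectors $e_1, \dots, e_n$ are the standard basis of $\mathbb{R}^n$. *)

(* Defs.v *)
From HB Require Import structures.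
From mathcomp Require Import all_boot all_order all_algebra.
From mathcomp Require Import all_classical all_reals all_analysis.

Set Implicit Arguments.
Unset Strict Implicit.
Unset Printing Implicit Defensive.

Import Order.TTheory GRing.Theory Num.Theory.
Import numFieldNormedType.Exports.

Local Open Scope classical_set_scope.
Local Open Scope ring_scope.

Notation borelRn R n := (g_sigma_algebraType (@open 'cV[R]_n)).

Definition dotp (R : realType) (n : nat) (x y : 'cV[R]_n) : R :=
  (x^T *m y) 0 0.

Definition std_basis (R : realType) (n : nat) (i : 'I_n) : 'cV[R]_n :=
  delta_mx i 0.

Record is_norm (R : realType) (n : nat) (N : 'cV[R]_n -> R) : Prop := IsNorm {
  is_norm_triangle : forall x y, N (x + y) <= N x + N y;
  is_norm_scale : forall (a : R) x, N (a *: x) = `|a| * N x;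
  is_norm_definite : forall x, N x = 0 -> x = 0
}.

(* The supremum is that of a nonempty bounded set of reals whenever N is a
   norm, so the default value of [sup] plays no role. *)
Definition dual_norm (R : realType) (n : nat) (N : 'cV[R]_n -> R)
    (x : 'cV[R]_n) : R :=
  sup [set dotp x y | y in [set y | N y <= 1]].

(* [`|x|] on ['cV[R]_n] is the largest absolute value of an entry
   (see [mx_normrE]). *)
Definition infty_norm (R : realType) (n : nat) (x : 'cV[R]_n) : R := `|x|.

Definition finite_first_moment (R : realType) (n : nat) (N : 'cV[R]_n -> R)
    (P : probability (borelRn R n) R) : Prop :=
  ('E_P[N] < +oo)%E.

Definition support_function (R : realType) (n : nat) (X : set 'cV[R]_n)
    (y : 'cV[R]_n) : \bar R :=
  ereal_sup [set (dotp x y)%:E | x in X].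

(* A minimization problem over T is given by its feasible set F and its
   objective f. *)
Definition optimal_value (R : realType) (T : Type) (F : set T)
    (f : T -> \bar R) : \bar R :=
  ereal_inf [set f z | z in F].

Definition optimal_solution (R : realType) (T : Type) (F : set T)
    (f : T -> \bar R) (z : T) : Prop :=
  F z /\ forall z', F z' -> (f z <= f z')%E.

Definition regret_objective (R : realType) (n : nat) (N : 'cV[R]_n -> R)
    (P : probability (borelRn R n) R) (r : R) (X : set 'cV[R]_n)
    (x : 'cV[R]_n) : \bar R :=
  ('E_P[fun w => dotp w x] +
   r%:E * ereal_sup [set (dual_norm N (x - v))%:E | v in X])%E.

Definition epigraph_feasible (R : realType) (n : nat) (X : set 'cV[R]_n) :
    set ('cV[R]_n * R) :=
  [set xl | [/\ X xl.1,
    forall i : 'I_n, (support_function X (std_basis R i)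
                      - (dotp (std_basis R i) xl.1)%:E <= xl.2%:E)%E
    & forall i : 'I_n, (support_function X (- std_basis R i)
                      + (dotp (std_basis R i) xl.1)%:E <= xl.2%:E)%E]].

Definition epigraph_objective (R : realType) (n : nat)
    (P : probability (borelRn R n) R) (r : R) (xl : 'cV[R]_n * R) : \bar R :=
  ('E_P[fun w => dotp w xl.1] + (r * xl.2)%:E)%E.

(* Main.v *)
Require Import Defs.
From HB Require Import structures.
From mathcomp Require Import all_boot all_order all_algebra.
From mathcomp Require Import all_classical all_reals all_analysis.

Import Order.TTheory GRing.Theory Num.Theory.
Import numFieldNormedType.Exports.

Local Open Scope classical_set_scope.
Local Open Scope ring_scope.

(** Write [d x] for the largest sup-norm distance from [x] to a point of [X];
it is a real number because [X] is nonempty and bounded.  The inequality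
[`|x - v| <= l] says that every coordinate satisfies [v i - x i <= l] and
[x i - v i <= l]; taking the supremum over [v] coordinate by coordinate turns
these into the support-function constraints, so that [(x, l)] is feasible for
the second problem exactly when [X x] and [d x <= l]
([epigraph_feasibleP]).  The second problem is therefore the epigraph form of
the minimization of [E x + r * d x], with [E x] the expected cost, and since
[r >= 0] the choice [l = d x] is optimal for each fixed [x]
([optimal_value_epigraph], [optimal_solution_epigraph]).  That last step is the
monotonicity of addition in the extended reals. *)

Section epigraph_form.
Context {R : realType} {T : Type}.
Variables (F : set T) (E : T -> \bar R) (r : R) (d : T -> R).
Hypothesis r_ge0 : 0 <= r.

Let f x := (E x + (r * d x)%:E)%E.
Let G : set (T * R) := [set xl | F xl.1 /\ d xl.1 <= xl.2].
Let g (xl : T * R) := (E xl.1 + (r * xl.2)%:E)%E.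

Let le_objective xl : G xl -> (f xl.1 <= g xl)%E.
Proof. by move=> [_ dl]; rewrite /f /g leeD2l// lee_fin ler_wpM2l. Qed.

Lemma optimal_value_epigraph : optimal_value F f = optimal_value G g.
Proof.
apply/eqP; rewrite eq_le; apply/andP; split; apply: le_ereal_inf_tmp.
- move=> _ [xl Gxl <-]; apply: ge_ereal_inf.
  by exists (f xl.1); [exists xl.1 => //; case: Gxl|exact: le_objective].
- move=> _ [x Fx <-]; apply: ge_ereal_inf.
  by exists (g (x, d x)) => //; exists (x, d x).
Qed.

(** A multiplier [l] witnessing optimality in the epigraph form need not be
[d x] (any [l >= d x] works when [r = 0]), which is why the converse compares
with [f x <= g (x, l)] instead of identifying [l]. *)
Lemma optimal_solution_epigraph x :
  optimal_solution F f x <-> exists l, optimal_solution G g (x, l).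
Proof.
split=> [[Fx fmin]|[l [Gxl gmin]]].
- exists (d x); split=> // xl Gxl.
  exact: (le_trans (fmin xl.1 (proj1 Gxl)) (le_objective _ Gxl)).
- split=> [|y Fy]; first by case: Gxl.
  exact: (le_trans (le_objective _ Gxl) (gmin (y, d y) (conj Fy (lexx _)))).
Qed.

End epigraph_form.

Section coordinates.
Context {R : realType} {n : nat}.
Implicit Types (x y : 'cV[R]_n) (X : set 'cV[R]_n).

Lemma dotpC x y : dotp x y = dotp y x.
Proof. by rewrite /dotp !mxE; apply: eq_bigr => i _; rewrite !mxE mulrC. Qed.

Lemma dotp_std_basis x i : dotp (std_basis R i) x = x i 0.
Proof. by rewrite /dotp /std_basis trmx_delta -rowE mxE. Qed.

Lemma dotpNr x y : dotp x (- y) = - dotp x y.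
Proof. by rewrite /dotp mulmxN mxE. Qed.

Lemma infty_norm_le x (l : R) : 0 <= l ->
  infty_norm x <= l <-> forall i, `|x i 0| <= l.
Proof.
move=> l0; rewrite /infty_norm [in `|x|]/Num.norm/= mx_normrE; split=> [/bigmax_leP[_ xl] i|xl].
  exact: (xl (i, 0)).
by apply/bigmax_leP; split=> // -[i j] _ /=; rewrite ord1.
Qed.

Lemma support_functionP X y (l : R) :
  (support_function X y <= l%:E)%E <-> forall v, X v -> dotp v y <= l.
Proof.
split=> [le_l v Xv|le_l].
  rewrite -lee_fin; apply: le_trans le_l.
  by apply: ereal_sup_ubound; exists v.
by apply: ge_ereal_sup => _ [v Xv <-]; rewrite lee_fin le_l.
Qed.

(** The constraints bound [`|x i 0 - v i 0|] by splitting the absolute value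
into its two signs; a coordinate exists and [X] is inhabited, so they also
force [l >= 0], which the sup norm needs. *)
Lemma epigraph_feasibleP X x (l : R) : (0 < n)%N -> X !=set0 ->
  epigraph_feasible X (x, l) <->
  X x /\ forall v, X v -> infty_norm (x - v) <= l.
Proof.
move=> n_gt0 [v0 Xv0].
have upP i : (support_function X (std_basis R i)
      - (dotp (std_basis R i) x)%:E <= l%:E)%E <->
    forall v, X v -> v i 0 - x i 0 <= l.
  rewrite leeBlDr// -EFinD support_functionP dotp_std_basis.
  by split=> H v /H; rewrite dotpC dotp_std_basis lerBlDr.
have downP i : (support_function X (- std_basis R i)
      + (dotp (std_basis R i) x)%:E <= l%:E)%E <->
    forall v, X v -> x i 0 - v i 0 <= l.
  rewrite -leeBrDr// -EFinB support_functionP dotp_std_basis.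
  by split=> H v /H; rewrite dotpNr dotpC dotp_std_basis lerBrDr addrC.
split=> [[/= Xx up down]|[Xx dist]].
- have xvl v i : X v -> `|(x - v) i 0| <= l.
    move=> Xv; rewrite !mxE ler_norml lerNl opprB.
    by apply/andP; split; [apply/upP: v Xv|apply/downP: v Xv].
  split=> // v Xv; apply/infty_norm_le => [|i]; last exact: xvl.
  exact: le_trans (normr_ge0 _) (xvl v0 (Ordinal n_gt0) Xv0).
- have l0 : 0 <= l by exact: le_trans (normr_ge0 _) (dist v0 Xv0).
  have xvl v i : X v -> `|x i 0 - v i 0| <= l.
    by move=> /dist /(infty_norm_le _ _ l0) /(_ i); rewrite !mxE.
  split=> //= i; [apply/upP|apply/downP] => v /(xvl v i).
    by rewrite distrC; exact/le_trans/ler_norm.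
  exact/le_trans/ler_norm.
Qed.

(** This is what makes the farthest distance an admissible value of the real
variable [l] in the epigraph form. *)
Lemma farthest_distance_fin_num X x : X !=set0 -> compact X ->
  ereal_sup [set (infty_norm (x - v))%:E | v in X] \is a fin_num.
Proof.
move=> [v0 Xv0] /compact_bounded[M [_ XM]].
apply: fin_real; apply/andP; split.
  apply: (lt_le_trans (ltNyr (infty_norm (x - v0)))).
  by apply: ereal_sup_ubound; exists v0.
apply: le_lt_trans (ltry (`|x| + (M + 1))).
apply: ge_ereal_sup => _ [v Xv <-]; rewrite lee_fin /infty_norm.
apply: le_trans (ler_normB _ _) _; rewrite lerD2l.
by apply: (XM (M + 1)) => //; rewrite ltrDl.
Qed.

End coordinates.

Theorem corollary1 (R : realType) (n : nat) (n_gt0 : (0 < n)%N)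
    (N : 'cV[R]_n -> R) (normN : is_norm N)
    (r : R) (r_ge0 : 0 <= r)
    (P0 : probability (borelRn R n) R) (P0M : finite_first_moment N P0)
    (X : set 'cV[R]_n) (X_nonempty : X !=set0) (X_compact : compact X)
    (dualN : forall x : 'cV[R]_n, dual_norm N x = infty_norm x) :
  optimal_value X (regret_objective N P0 r X)
    = optimal_value (epigraph_feasible X) (epigraph_objective P0 r)
  /\ (forall x : 'cV[R]_n, X x ->
       (optimal_solution X (regret_objective N P0 r X) x <->
        exists l : R,
          optimal_solution (epigraph_feasible X) (epigraph_objective P0 r)
            (x, l))).
Proof.
pose D x := ereal_sup [set (infty_norm (x - v))%:E | v in X].
have D_fin x : (fine (D x))%:E = D x.
  by rewrite fineK// farthest_distance_fin_num.
have -> : regret_objective N P0 r X =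
    fun x => ('E_P0[fun w => dotp w x] + (r * fine (D x))%:E)%E.
  apply/funext => x; rewrite /regret_objective EFinM D_fin.
  by have -> : dual_norm N = @infty_norm R n by exact/funext.
have -> : epigraph_feasible X = [set xl | X xl.1 /\ fine (D xl.1) <= xl.2].
  apply/seteqP; split=> -[x l] /=.
    move=> /(epigraph_feasibleP _ _ _ n_gt0 X_nonempty)[Xx dist]; split=> //.
    rewrite -lee_fin D_fin; apply: ge_ereal_sup => _ [v Xv <-].
    by rewrite lee_fin dist.
  move=> [Xx]; rewrite -lee_fin D_fin => Dl.
  apply/(epigraph_feasibleP _ _ _ n_gt0 X_nonempty); split=> // v Xv.
  rewrite -lee_fin; apply: le_trans Dl.
  by apply: ereal_sup_ubound; exists v.
split; first exact: optimal_value_epigraph.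
by move=> x _; exact: optimal_solution_epigraph.
Qed.
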